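(* Let $(H\xrightarrow{\partial}G,\ \alpha:G^{op}\to\mathrm{Aut}(H))$ be a crossed module of Lie groups and let $\mathcal G_\bullet$ be the associated strict Lie 2-group. The following data give a 2-representation of $\mathcal G_\bullet$ (that is, they underlie a pseudofunctor $B\mathcal G_\bullet\to2\mathsf{Vect}$): (i) the unique object $*$ of $B\mathcal G_\bullet$ is sent to the category $\mathsf{Rep}\,H$ of representations of $H$; (ii) each $g\in G$ is sent to the functor $F_g:\mathsf{Rep}\,H\to\mathsf{Rep}\,H$ with $F_g(V,\rho)=(V,\rho\circ\alpha(g))$ for a representation $(V,\rho:H\to\mathrm{Aut}(V))$, and $F_g\big((V,\rho)\xrightarrow{f}(V',\rho')\big)=\big((V,\rho\circ\alpha(g))\xrightarrow{f}(V',\rho'\circ\alpha(g))\big)$; (iii) each $(g_1,h)\in G\times H$, viewed as a 2-morphism from $g_1$ to $g_2=\partial(h)g_1$, is sent to the natural transformation $F_{(g_1,h)}:F_{g_1}\Rightarrow F_{g_2}$ with components $F_{(g_1,h)}(V,\rho):(V,\rho\circ\alpha(g_1))\to(V,\rho\circ\alpha(g_2))$, $v\mapsto\rho\big(\alpha(g_1)(h^{-1})\big)(v)$.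
   Context: $k$ is a field of characteristic zero; representations are on $k$-vector spaces. A crossed module of Lie groups $(H\xrightarrow{\partial}G,\alpha)$ consists of a Lie group morphism $\partial:H\to G$ and a right action of $G$ on $H$, i.e. a Lie group morphism $\alpha:G^{op}\to\mathrm{Aut}(H)$, such that $\partial(\alpha(g)h)=g^{-1}\partial(h)g$ and $\alpha(\partial(h))h'=h^{-1}h'h$. The associated strict Lie 2-group $\mathcal G_\bullet$ has object manifold $G$ and arrows $(g_1,h)$, $g_1\in G$, $h\in H$, with source $g_1$ and target $\partial(h)g_1$; vertical composition $(g_2,h_2)\cdot_v(g_1,h_1)=(g_1,h_2h_1)$ for $g_2=\partial(h_1)g_1$; and horizontal product given by multiplication in $G$ on objects and $(g_1,h)\cdot_h(g_1',h')=(g_1g_1',\,h\,\alpha(g_1^{-1})(h'))$ on arrows. $B\mathcal G_\bullet$ is the (strict) 2-category with one object $*$, hom-category $\mathcal G_\bullet$ and horizontal composition the horizontal product. $2\mathsf{Vect}$ is the strict 2-category of $k$-prelinear categories (hom-sets are $k$-vector spaces, composition $k$-bilinear), $k$-linear functors and natural transformations. *)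

(* Defs.v *)
From HB Require Import structures.
From mathcomp Require Import all_boot all_order all_algebra.
From mathcomp Require Import all_classical all_reals all_analysis.

Set Implicit Arguments.
Unset Strict Implicit.
Unset Printing Implicit Defensive.

Import GRing.Theory Num.Theory numFieldNormedType.Exports.

Local Open Scope classical_set_scope.
Local Open Scope ring_scope.

Section Smoothness.
Context {R : realType} {m n : nat}.

(* C^r on an open set, in the form: all iterated partial derivatives of order
   at most r exist and are continuous there. *)
Fixpoint continuously_differentiable (r : nat) (U : set 'rV[R]_m)
    (f : 'rV[R]_m -> 'rV[R]_n) : Prop :=
  {in U, continuous f} /\
  if r is r'.+1 then
    forall i : 'I_m,
      {in U, forall x, derivable f x (delta_mx ord0 i)} /\
      continuously_differentiable r' U (fun x => 'D_(delta_mx ord0 i) f x)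
  else True.

Definition smooth_on (U : set 'rV[R]_m) (f : 'rV[R]_m -> 'rV[R]_n) : Prop :=
  forall r, continuously_differentiable r U f.

End Smoothness.

(* A homeomorphism from an open subset of M onto an open subset of R^n. Both
   maps are total functions; only their values on [chart_dom] and [chart_img]
   are meaningful. *)
Record chart (R : realType) (M : topologicalType) (n : nat) := Chart {
  chart_dom : set M;
  chart_map :> M -> 'rV[R]_n;
  chart_inv : 'rV[R]_n -> M;
  chart_dom_open : open chart_dom;
  chart_img_open : open (chart_map @` chart_dom);
  chart_mapK : {in chart_dom, cancel chart_map chart_inv};
  chart_map_continuous : {in chart_dom, continuous chart_map};
  chart_inv_continuous : {in chart_map @` chart_dom, continuous chart_inv}
}.

Definition chart_img (R : realType) (M : topologicalType) (n : nat)
  (c : chart R M n) : set 'rV[R]_n := c @` chart_dom c.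

HB.mixin Record isSmoothManifold (R : realType) M of Topological M := {
  manifold_dim : nat;
  atlas : set (chart R M manifold_dim);
  atlas_cover : forall x : M, exists2 c, atlas c & chart_dom c x;
  atlas_compatible : forall c d, atlas c -> atlas d ->
    smooth_on (c @` (chart_dom c `&` chart_dom d)) (d \o chart_inv c);
  manifold_hausdorff : hausdorff_space M;
  manifold_second_countable : @second_countable M
}.

#[short(type="smoothManifoldType")]
HB.structure Definition SmoothManifold (R : realType) :=
  {M of isSmoothManifold R M & Topological M}.

Section SmoothMaps.
Context {R : realType}.

Definition smooth_map {M N : smoothManifoldType R} (f : M -> N) : Prop :=
  continuous f /\
  forall c d, @atlas R M c -> @atlas R N d ->
    smooth_on [set x | chart_img c x /\ chart_dom d (f (chart_inv c x))]
              (fun x => d (f (chart_inv c x))).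

(* Smoothness of a map on the product manifold M x N, read in product charts:
   a point of R^(m + n) is split into its coordinates in R^m and in R^n. *)
Definition smooth_map2 {M N P : smoothManifoldType R} (f : M -> N -> P) : Prop :=
  continuous (fun p : M * N => f p.1 p.2) /\
  forall c d e, @atlas R M c -> @atlas R N d -> @atlas R P e ->
    let g z := f (chart_inv c (lsubmx z)) (chart_inv d (rsubmx z)) in
    smooth_on
      [set z | [/\ chart_img c (lsubmx z), chart_img d (rsubmx z) &
                   chart_dom e (g z)]]
      (fun z => e (g z)).

End SmoothMaps.

HB.mixin Record isLieGroup (R : realType) G
    of SmoothManifold R G & Group G := {
  mulg_smooth : @smooth_map2 R G G G (fun x y => (x * y)%g);
  invg_smooth : @smooth_map R G G (fun x => x^-1%g)
}.

#[short(type="lieGroupType")]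
HB.structure Definition LieGroup (R : realType) :=
  {G of isLieGroup R G & SmoothManifold R G & Group G}.

(* [xact] is the right action written as a map alpha : G^op -> Aut(H), whence
   the order in [xactM]. Its smoothness is that of (g, h) |-> alpha(g)(h), which
   in particular makes each alpha(g) an automorphism of the Lie group H. *)
Record crossed_module (R : realType) (H G : lieGroupType R) := CrossedModule {
  xbd : {multiplicative H -> G};
  xbd_smooth : smooth_map xbd;
  xact : G -> {multiplicative H -> H};
  xact_smooth : smooth_map2 (fun g h => xact g h);
  xact1 : forall h, xact 1%g h = h;
  xactM : forall g g' h, xact (g * g')%g h = xact g' (xact g h);
  xbd_act : forall g h, xbd (xact g h) = (g^-1 * xbd h * g)%g;
  xact_bd : forall h h', xact (xbd h) h' = (h^-1 * h' * h)%g
}.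

Section TwoGroup.
Local Open Scope group_scope.
Context {R : realType} {H G : lieGroupType R} (X : crossed_module H G).

Definition arrow : Type := (G * H)%type.
Definition src (a : arrow) : G := a.1.
Definition tgt (a : arrow) : G := xbd X a.2 * a.1.
Definition unit_arrow (g : G) : arrow := (g, 1).
Definition vmul (b a : arrow) : arrow := (a.1, b.2 * a.2).
Definition hmul (a b : arrow) : arrow := (a.1 * b.1, a.2 * xact X a.1^-1 b.2).

Lemma xbd1 : xbd X 1 = 1.
Proof. by apply: (mulgI (xbd X 1)); rewrite -gmulfM !mulg1. Qed.

Lemma xact_1 g : xact X g 1 = 1.
Proof. by apply: (mulgI (xact X g 1)); rewrite -gmulfM !mulg1. Qed.

Lemma tgt_unit g : tgt (unit_arrow g) = g.
Proof. by rewrite /tgt /= xbd1 mul1g. Qed.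

Lemma tgt_vmul a b : src b = tgt a -> tgt (vmul b a) = tgt b.
Proof. by rewrite /tgt /src /= => ->; rewrite gmulfM mulgA. Qed.

Lemma tgt_hmul a b : tgt (hmul a b) = tgt a * tgt b.
Proof. by rewrite /tgt /= gmulfM xbd_act invgK !mulgA !mulgVK. Qed.

Lemma hmul_vmul a a' b b' : src a' = tgt a ->
  hmul (vmul a' a) (vmul b' b) = vmul (hmul a' b') (hmul a b).
Proof.
move: a a' b b' => [g h] [g' h'] [k l] [k' l']; rewrite /src /tgt /= => ->.
rewrite /hmul /vmul /= gmulfM; congr (_, _).
have -> : (xbd X h * g)^-1 = g^-1 * xbd X (h^-1).
  rewrite invgM; congr (_ * _).
  by apply: (mulgI (xbd X h)); rewrite mulgV -gmulfM mulgV xbd1.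
by rewrite xactM xact_bd invgK !mulgA mulgVK.
Qed.

Lemma hmulA a b c : hmul a (hmul b c) = hmul (hmul a b) c.
Proof.
by rewrite /hmul /= gmulfM invgM xactM !mulgA.
Qed.

Lemma hmul1a a : hmul (unit_arrow 1) a = a.
Proof. by case: a => g h; rewrite /hmul /= invg1 xact1 !mul1g. Qed.

Lemma hmula1 a : hmul a (unit_arrow 1) = a.
Proof. by case: a => g h; rewrite /hmul /= xact_1 !mulg1. Qed.

Lemma hmul_unit g g' :
  hmul (unit_arrow g) (unit_arrow g') = unit_arrow (g * g').
Proof. by rewrite /hmul /= xact_1 mulg1. Qed.

Record two_cell (g1 g2 : G) := TwoCell {
  cell_arrow :> arrow;
  cell_src : src cell_arrow = g1;
  cell_tgt : tgt cell_arrow = g2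
}.

Definition arrow_cell (g : G) (h : H) : two_cell g (xbd X h * g) :=
  @TwoCell g (xbd X h * g) (g, h) erefl erefl.

Lemma two_cell_inj g1 g2 (a b : two_cell g1 g2) :
  a = b :> arrow -> a = b.
Proof.
case: a b => [a sa ta] [b sb tb] /= eab; case: b / eab sb tb => sb tb.
by congr TwoCell; exact: Prop_irrelevance.
Qed.

Definition unit_cell g : two_cell g g :=
  @TwoCell g g (unit_arrow g) erefl (tgt_unit g).

Lemma cell_composable g1 g2 g3 (b : two_cell g2 g3) (a : two_cell g1 g2) :
  src b = tgt a.
Proof. by rewrite cell_src cell_tgt. Qed.

Definition vcell g1 g2 g3 (b : two_cell g2 g3) (a : two_cell g1 g2) :
    two_cell g1 g3 :=
  @TwoCell g1 g3 (vmul b a) (cell_src a)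
    (etrans (tgt_vmul (cell_composable b a)) (cell_tgt b)).

Definition hcell g1 g2 g1' g2' (a : two_cell g1 g2) (b : two_cell g1' g2') :
    two_cell (g1 * g1') (g2 * g2') :=
  @TwoCell (g1 * g1') (g2 * g2') (hmul a b)
    (congr2 _ (cell_src a) (cell_src b))
    (etrans (tgt_hmul a b) (congr2 _ (cell_tgt a) (cell_tgt b))).

End TwoGroup.

(* The 2-cell induced by an equality of parallel 1-cells. *)
Definition eq_cell {A : Type} {C : A -> A -> Type} (i : forall a, C a a)
    {a b : A} (e : a = b) : C a b :=
  match e in _ = b return C a b with erefl => i a end.

(* Composites are written in applicative order: [comp1 g f] is g after f. The
   1-cells compose strictly; since equality of composite 1-cells need not be a
   conversion, the strict laws for horizontal composition of 2-cells are stated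
   up to the identity 2-cells [eq_cell] between equal 1-cells. *)
Record two_category := TwoCategory {
  ob :> Type;
  hom1 : ob -> ob -> Type;
  hom2 : forall x y, hom1 x y -> hom1 x y -> Type;
  id1 : forall x, hom1 x x;
  comp1 : forall x y z, hom1 y z -> hom1 x y -> hom1 x z;
  id2 : forall x y (f : hom1 x y), hom2 f f;
  vcomp : forall x y (f g h : hom1 x y), hom2 g h -> hom2 f g -> hom2 f h;
  hcomp : forall x y z (f f' : hom1 x y) (g g' : hom1 y z),
    hom2 g g' -> hom2 f f' -> hom2 (comp1 g f) (comp1 g' f');
  vcompA : forall x y (f g h k : hom1 x y)
      (c : hom2 h k) (b : hom2 g h) (a : hom2 f g),
    vcomp c (vcomp b a) = vcomp (vcomp c b) a;
  vcomp1l : forall x y (f g : hom1 x y) (a : hom2 f g), vcomp (id2 g) a = a;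
  vcomp1r : forall x y (f g : hom1 x y) (a : hom2 f g), vcomp a (id2 f) = a;
  hcomp_id : forall x y z (f : hom1 x y) (g : hom1 y z),
    hcomp (id2 g) (id2 f) = id2 (comp1 g f);
  hcomp_vcomp : forall x y z (f f' f'' : hom1 x y) (g g' g'' : hom1 y z)
      (b' : hom2 g' g'') (b : hom2 g g') (a' : hom2 f' f'') (a : hom2 f f'),
    hcomp (vcomp b' b) (vcomp a' a) = vcomp (hcomp b' a') (hcomp b a);
  comp1A : forall x y z w (f : hom1 x y) (g : hom1 y z) (h : hom1 z w),
    comp1 h (comp1 g f) = comp1 (comp1 h g) f;
  comp1l : forall x y (f : hom1 x y), comp1 (id1 y) f = f;
  comp1r : forall x y (f : hom1 x y), comp1 f (id1 x) = f;
  hcompA : forall x y z w (f f' : hom1 x y) (g g' : hom1 y z) (h h' : hom1 z w)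
      (a : hom2 f f') (b : hom2 g g') (c : hom2 h h'),
    vcomp (eq_cell (@id2 x w) (comp1A f' g' h')) (hcomp c (hcomp b a)) =
    vcomp (hcomp (hcomp c b) a) (eq_cell (@id2 x w) (comp1A f g h));
  hcomp1l : forall x y (f f' : hom1 x y) (a : hom2 f f'),
    vcomp (eq_cell (@id2 x y) (comp1l f')) (hcomp (id2 (id1 y)) a) =
    vcomp a (eq_cell (@id2 x y) (comp1l f));
  hcomp1r : forall x y (f f' : hom1 x y) (a : hom2 f f'),
    vcomp (eq_cell (@id2 x y) (comp1r f')) (hcomp a (id2 (id1 x))) =
    vcomp a (eq_cell (@id2 x y) (comp1r f))
}.

Arguments id1 {t} x.
Arguments id2 {t x y} f.

Notation eq2 e := (eq_cell (fun f => id2 f) e).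

Definition invertible2 (C : two_category) (x y : C) (f g : hom1 x y)
    (a : hom2 f g) : Prop :=
  exists b : hom2 g f, vcomp b a = id2 f /\ vcomp a b = id2 g.

Record pseudofunctor_data (B C : two_category) := PseudofunctorData {
  pf0 : B -> C;
  pf1 : forall x y, hom1 x y -> hom1 (pf0 x) (pf0 y);
  pf2 : forall x y (f g : hom1 x y), hom2 f g -> hom2 (pf1 f) (pf1 g)
}.

Record pseudofunctor (B C : two_category) := Pseudofunctor {
  pf_data :> pseudofunctor_data B C;
  pf2_id : forall x y (f : @hom1 B x y), pf2 pf_data (id2 f) = id2 (pf1 pf_data f);
  pf2_vcomp : forall x y (f g h : @hom1 B x y) (b : hom2 g h) (a : hom2 f g),
    pf2 pf_data (vcomp b a) = vcomp (pf2 pf_data b) (pf2 pf_data a);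
  pf_comp : forall x y z (g : @hom1 B y z) (f : hom1 x y),
    hom2 (comp1 (pf1 pf_data g) (pf1 pf_data f)) (pf1 pf_data (comp1 g f));
  pf_comp_inv : forall x y z (g : @hom1 B y z) (f : hom1 x y),
    invertible2 (pf_comp g f);
  pf_comp_nat : forall x y z (g g' : @hom1 B y z) (f f' : hom1 x y)
      (b : hom2 g g') (a : hom2 f f'),
    vcomp (pf_comp g' f') (hcomp (pf2 pf_data b) (pf2 pf_data a)) =
    vcomp (pf2 pf_data (hcomp b a)) (pf_comp g f);
  pf_unit : forall x : B, hom2 (id1 (pf0 pf_data x)) (pf1 pf_data (id1 x));
  pf_unit_inv : forall x : B, invertible2 (pf_unit x);
  pf_assoc : forall x y z w (h : @hom1 B z w) (g : hom1 y z) (f : hom1 x y),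
    vcomp (pf_comp (comp1 h g) f)
      (vcomp (hcomp (pf_comp h g) (id2 (pf1 pf_data f)))
        (eq2 (comp1A (pf1 pf_data f) (pf1 pf_data g) (pf1 pf_data h)))) =
    vcomp (pf2 pf_data (eq2 (comp1A f g h)))
      (vcomp (pf_comp h (comp1 g f))
        (hcomp (id2 (pf1 pf_data h)) (pf_comp g f)));
  pf_unitl : forall x y (f : @hom1 B x y),
    vcomp (pf2 pf_data (eq2 (comp1l f)))
      (vcomp (pf_comp (id1 y) f) (hcomp (pf_unit y) (id2 (pf1 pf_data f)))) =
    eq2 (comp1l (pf1 pf_data f));
  pf_unitr : forall x y (f : @hom1 B x y),
    vcomp (pf2 pf_data (eq2 (comp1r f)))
      (vcomp (pf_comp f (id1 x)) (hcomp (id2 (pf1 pf_data f)) (pf_unit x))) =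
    eq2 (comp1r (pf1 pf_data f))
}.

Section Delooping.
Context {R : realType} {H G : lieGroupType R} (X : crossed_module H G).
Local Open Scope group_scope.

Lemma eq_two_cellE (g1 g2 : G) (e : g1 = g2) :
  (eq_cell (unit_cell X) e : two_cell X g1 g2) = unit_arrow g1 :> arrow.
Proof. by case: g2 / e. Qed.

Lemma vmul_eql (g1 g2 g3 : G) (e : g2 = g3) (a : two_cell X g1 g2) :
  vcell (eq_cell (unit_cell X) e) a = a :> arrow.
Proof. by case: g3 / e; rewrite /= /vmul mul1g; case: (cell_arrow a). Qed.

Lemma vmul_eqr (g1 g2 g3 : G) (e : g1 = g2) (a : two_cell X g2 g3) :
  vcell a (eq_cell (unit_cell X) e) = a :> arrow.
Proof.
case: g2 / e a => a; rewrite /= /vmul /= mulg1.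
by case: a => -[g h] /= <-.
Qed.

Definition deloop : two_category.
Proof.
refine (@TwoCategory unit (fun _ _ => G) (fun _ _ => two_cell X)
  (fun _ => 1) (fun _ _ _ g f => g * f)
  (fun _ _ => unit_cell X) (fun _ _ => @vcell _ _ _ X)
  (fun _ _ _ f f' g g' b a => hcell b a)
  _ _ _ _ _ (fun _ _ _ _ f g h => mulgA h g f)
  (fun _ _ => @mul1g G) (fun _ _ => @mulg1 G) _ _ _).
- by move=> *; apply: two_cell_inj; rewrite /= /vmul mulgA.
- by move=> _ _ f g a; apply: two_cell_inj; exact: (vmul_eql erefl a).
- by move=> _ _ f g a; apply: two_cell_inj; exact: (vmul_eqr erefl a).
- by move=> *; apply: two_cell_inj; exact: hmul_unit.
- by move=> *; apply: two_cell_inj; apply: hmul_vmul; exact: cell_composable.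
- move=> *; apply: two_cell_inj; rewrite vmul_eql vmul_eqr; exact: hmulA.
- move=> *; apply: two_cell_inj; rewrite vmul_eql vmul_eqr; exact: hmul1a.
- move=> *; apply: two_cell_inj; rewrite vmul_eql vmul_eqr; exact: hmula1.
Defined.

End Delooping.

Record prelinear_category (k : fieldType) := PrelinearCategory {
  obj :> Type;
  hom : obj -> obj -> lmodType k;
  idm : forall x, hom x x;
  compm : forall x y z, hom y z -> hom x y -> hom x z;
  compmA : forall x y z w (h : hom z w) (g : hom y z) (f : hom x y),
    compm h (compm g f) = compm (compm h g) f;
  compm1l : forall x y (f : hom x y), compm (idm y) f = f;
  compm1r : forall x y (f : hom x y), compm f (idm x) = f;
  compm_linearl : forall x y z (f : hom x y), linear (fun g : hom y z => compm g f);
  compm_linearr : forall x y z (g : hom y z), linear (fun f : hom x y => compm g f)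
}.

Arguments idm {k p} x.

Record linear_functor (k : fieldType) (A B : prelinear_category k) :=
    LinearFunctor {
  fobj :> A -> B;
  fmap : forall x y, hom x y -> hom (fobj x) (fobj y);
  fmap_id : forall x, fmap (idm x) = idm (fobj x);
  fmap_comp : forall x y z (g : hom y z) (f : hom x y),
    fmap (compm g f) = compm (fmap g) (fmap f);
  fmap_linear : forall x y, linear (@fmap x y)
}.

Record nat_trans (k : fieldType) (A B : prelinear_category k)
    (F G : linear_functor A B) := NatTrans {
  component :> forall x, hom (F x) (G x);
  naturality : forall x y (f : hom x y),
    compm (component y) (fmap F f) = compm (fmap G f) (component x)
}.

Section TwoVect.
Variable k : fieldType.
Implicit Types A B C D : prelinear_category k.

Lemma linear_functor_eq A B (fo : A -> B)
    (fm : forall x y, hom x y -> hom (fo x) (fo y)) i i' c c' l l' :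
  @LinearFunctor k A B fo fm i c l = @LinearFunctor k A B fo fm i' c' l'.
Proof. by congr LinearFunctor; exact: Prop_irrelevance. Qed.

Lemma nat_trans_eq A B (F G : linear_functor A B) (a b : nat_trans F G) :
  (forall x, a x = b x) -> a = b.
Proof.
case: a b => [a na] [b nb] /= ab.
have eab : a = b by exact: functional_extensionality_dep.
by case: b / eab {ab} nb => nb; congr NatTrans; exact: Prop_irrelevance.
Qed.

Program Definition id_functor A : linear_functor A A :=
  @LinearFunctor k A A id (fun _ _ => id) _ _ _.
Next Obligation. by []. Qed.
Next Obligation. by []. Qed.
Next Obligation. by []. Qed.

Program Definition comp_functor A B C
    (G : linear_functor B C) (F : linear_functor A B) : linear_functor A C :=
  @LinearFunctor k A C (fun x => G (F x)) (fun _ _ f => fmap G (fmap F f)) _ _ _.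
Next Obligation. by move=> * /=; rewrite !fmap_id. Qed.
Next Obligation. by move=> * /=; rewrite !fmap_comp. Qed.
Next Obligation. by move=> A B C G F x y a f g /=; rewrite !fmap_linear. Qed.

Program Definition id_trans A B (F : linear_functor A B) : nat_trans F F :=
  @NatTrans k A B F F (fun x => idm (F x)) _.
Next Obligation. by move=> * /=; rewrite compm1l compm1r. Qed.

Program Definition vcomp_trans A B (F G K : linear_functor A B)
    (b : nat_trans G K) (a : nat_trans F G) : nat_trans F K :=
  @NatTrans k A B F K (fun x => compm (b x) (a x)) _.
Next Obligation.
by move=> A B F G K b a x y f /=; rewrite -compmA naturality !compmA naturality.
Qed.

Program Definition hcomp_trans A B C (F F' : linear_functor A B)
    (G G' : linear_functor B C) (b : nat_trans G G') (a : nat_trans F F') :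
    nat_trans (comp_functor G F) (comp_functor G' F') :=
  @NatTrans k A C (comp_functor G F) (comp_functor G' F')
    (fun x => compm (b (F' x)) (fmap G (a x))) _.
Next Obligation.
move=> A B C F F' G G' b a x y f /=.
by rewrite -compmA -fmap_comp (naturality a) fmap_comp !compmA naturality.
Qed.

Lemma comp_functorA A B C D (F : linear_functor A B) (G : linear_functor B C)
    (K : linear_functor C D) :
  comp_functor K (comp_functor G F) = comp_functor (comp_functor K G) F.
Proof. exact: linear_functor_eq. Qed.

Lemma comp_functor1l A B (F : linear_functor A B) :
  comp_functor (id_functor B) F = F.
Proof. by case: F => *; exact: linear_functor_eq. Qed.

Lemma comp_functor1r A B (F : linear_functor A B) :
  comp_functor F (id_functor A) = F.
Proof. by case: F => *; exact: linear_functor_eq. Qed.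

Lemma eq_transE A B (F G : linear_functor A B) (e : F = G) (x : A) :
  (eq_cell (@id_trans A B) e : nat_trans F G) x =
  eq_cell (C := @hom k B) (fun y => idm y)
    (congr1 (fun K : linear_functor A B => K x) e).
Proof. by case: G / e. Qed.

(* The component at x of the 2-cell of an equality F = G is an identity as soon
   as F x and G x are convertible. *)
Lemma eq_cell_idm A (x : A) (e : x = x) : 
  eq_cell (C := @hom k A) (fun y => idm y) e = idm x.
Proof. by rewrite (Prop_irrelevance e erefl). Qed.

Definition TwoVect : two_category.
Proof.
refine (@TwoCategory (prelinear_category k) (@linear_functor k) (@nat_trans k)
  id_functor comp_functor id_trans vcomp_trans hcomp_trans
  _ _ _ _ _ comp_functorA comp_functor1l comp_functor1r _ _ _).
- by move=> *; apply: nat_trans_eq => x /=; rewrite compmA.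
- by move=> *; apply: nat_trans_eq => x /=; rewrite compm1l.
- by move=> *; apply: nat_trans_eq => x /=; rewrite compm1r.
- by move=> *; apply: nat_trans_eq => x /=; rewrite fmap_id compm1l.
- move=> A B C F F' F'' G G' G'' b' b a' a; apply: nat_trans_eq => x /=.
  by rewrite fmap_comp -!compmA; congr compm; rewrite !compmA naturality.
- move=> A B C D F F' G G' K K' a b c; apply: nat_trans_eq => x /=.
  rewrite !eq_transE !eq_cell_idm compm1l compm1r.
  by rewrite fmap_comp compmA.
- move=> A B F F' a; apply: nat_trans_eq => x /=.
  by rewrite !eq_transE !eq_cell_idm /= compm1r !compm1l.
- move=> A B F F' a; apply: nat_trans_eq => x /=.
  by rewrite !eq_transE !eq_cell_idm fmap_id !compm1r compm1l.
Defined.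

End TwoVect.

(* A homomorphism from H to the group of linear automorphisms of V; V is an
   arbitrary k-vector space and no continuity is required. *)
Record representation (k : fieldType) (H : groupType) := Representation {
  rep_space :> lmodType k;
  rep_act : H -> rep_space -> rep_space;
  rep_linear : forall h, linear (rep_act h);
  rep_bij : forall h, bijective (rep_act h);
  rep_actM : forall h h' v, rep_act (h * h')%g v = rep_act h (rep_act h' v)
}.

Section Intertwiners.
Context {k : fieldType} {H : groupType}.
Implicit Types U V W : representation k H.

Definition intertwining V W : {pred V -> W} :=
  fun f => `[< linear f /\ forall h v, f (rep_act h v) = rep_act h (f v) >].
Arguments intertwining V W : clear implicits.

Record intertwiner V W := Intertwiner {
  intertwiner_fun :> V -> W;
  intertwinerP : intertwiner_fun \in intertwining V W
}.

Lemma intertwining_submod V W : submod_closed (intertwining V W).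
Proof.
have rZD (U : representation k H) h (a : k) (u v : U) :
    rep_act h (a *: u + v) = a *: rep_act h u + rep_act h v.
  exact: rep_linear.
have r0 (U : representation k H) h : rep_act h (0 : U) = 0.
  by have := rZD U h (-1) 0 0; rewrite !scaleN1r oppr0 addr0 addNr.
split.
  by apply/asboolP; split=> [a u v|h v]; rewrite /= ?scaler0 ?addr0 // r0.
move=> a f g /asboolP[lf ef] /asboolP[lg eg]; apply/asboolP; split=> [b u v|h v].
  rewrite /= !fctE lf lg !scalerDr !scalerA (mulrC a b) -!addrA.
  by congr (_ + _); rewrite addrCA.
by rewrite !fctE ef eg rZD.
Qed.

HB.instance Definition _ V W :=
  GRing.isSubmodClosed.Build k (V -> W) (intertwining V W)
    (intertwining_submod V W).
HB.instance Definition _ V W := [isSub for @intertwiner_fun V W].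
HB.instance Definition _ V W := [Choice of intertwiner V W by <:].
HB.instance Definition _ V W := [SubChoice_isSubLmodule of intertwiner V W by <:].

End Intertwiners.

Arguments intertwining {k H} V W.

Section RepresentationCategory.
Variables (k : fieldType) (H : groupType).
Implicit Types U V W : representation k H.

Lemma intertwiner_linear V W (f : intertwiner V W) : linear f.
Proof. by case: f => f /= /asboolP[]. Qed.

Lemma intertwiner_act V W (f : intertwiner V W) h v :
  f (rep_act h v) = rep_act h (f v).
Proof. by case: f => f /= /asboolP[]. Qed.

Lemma intertwiner_eq V W (f g : intertwiner V W) : f =1 g -> f = g.
Proof. by move=> fg; apply: val_inj; exact/funext. Qed.

Lemma id_intertwining V : (id : V -> V) \in intertwining V V.
Proof. exact/asboolP. Qed.

Lemma comp_intertwining U V W (g : intertwiner V W) (f : intertwiner U V) :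
  (fun v => g (f v)) \in intertwining U W.
Proof.
apply/asboolP; split=> [a u v|h v]; first by rewrite !intertwiner_linear.
by rewrite !intertwiner_act.
Qed.

Program Definition Rep : prelinear_category k :=
  @PrelinearCategory k (representation k H)
    (fun V W => intertwiner V W : lmodType k)
    (fun V => Intertwiner (id_intertwining V))
    (fun U V W g f => Intertwiner (comp_intertwining g f)) _ _ _ _ _.
Next Obligation. by move=> *; exact: intertwiner_eq. Qed.
Next Obligation. by move=> *; exact: intertwiner_eq. Qed.
Next Obligation. by move=> *; exact: intertwiner_eq. Qed.
Next Obligation. by move=> U V W f a g g'; exact: intertwiner_eq. Qed.
Next Obligation.
move=> U V W g a f f'; apply: intertwiner_eq => v /=.
exact: intertwiner_linear.
Qed.

End RepresentationCategory.

Section Twist.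
Context {R : realType} {H G : lieGroupType R}.
Variables (k : fieldType) (X : crossed_module H G) (g : G).

Program Definition twist_rep (V : representation k H) : representation k H :=
  @Representation k H V (fun h => @rep_act k H V (xact X g h)) _ _ _.
Next Obligation. by move=> V h; exact: rep_linear. Qed.
Next Obligation. by move=> V h; exact: rep_bij. Qed.
Next Obligation. by move=> V h h' v /=; rewrite gmulfM rep_actM. Qed.

Lemma twist_intertwining (V W : representation k H) (f : intertwiner V W) :
  (f : V -> W) \in intertwining (twist_rep V) (twist_rep W).
Proof.
apply/asboolP; split=> [a u v|h v]; first exact: (intertwiner_linear f a u v).
exact: (intertwiner_act f _ v).
Qed.

Program Definition twist : linear_functor (Rep k H) (Rep k H) :=
  @LinearFunctor k (Rep k H) (Rep k H) twist_rep
    (fun V W f => Intertwiner (twist_intertwining f)) _ _ _.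
Next Obligation. by move=> V; apply: (@intertwiner_eq k H) => v. Qed.
Next Obligation. by move=> * /=; apply: (@intertwiner_eq k H) => v. Qed.
Next Obligation. by move=> V W a f f'; apply: intertwiner_eq. Qed.

End Twist.

Definition two_representation (R : realType) (H G : lieGroupType R)
    (k : fieldType) (X : crossed_module H G) :=
  pseudofunctor (deloop X) (TwoVect k).

(* Main.v *)
Require Import Defs.
From mathcomp Require Import all_boot all_order all_algebra.
From mathcomp Require Import all_classical all_reals all_analysis.

(** The assignment is a strict 2-functor in all but the formal sense. Since
    [alpha] is a homomorphism from the opposite group of [G], twisting by [f]
    and then by [g] gives the action [rho (alpha f (alpha g x))], which is
    [rho (alpha (g f) x)]: the composite of the functors attached to [g] and
    [f] and the functor attached to [g f] agree on underlying vector spaces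
    and have pointwise equal actions. The compositor and the unitor are
    therefore carried by identity maps of vector spaces, and all coherence
    conditions reduce to the fact that identity 2-cells act trivially.

    Everything that remains follows from one identity, the Peiffer relation in
    the form [alpha (bd h * g) x * alpha g h^-1 = alpha g h^-1 * alpha g x]
    ([xact_tgt]). It says that [rho (alpha g h^-1)] intertwines the two
    twists of [rho], so each 2-cell acts by a natural transformation
    ([cell_trans]). It also moves the factor coming from the later cell past
    the factor coming from the earlier one, which gives compatibility with
    vertical composition ([cell_trans_vcomp]) and with horizontal composition
    ([twist_comp_natural]). *)

Set Implicit Arguments.
Unset Strict Implicit.
Unset Printing Implicit Defensive.

Local Open Scope group_scope.

(** Bijectivity is what excludes a nontrivial idempotent as the action of the
    unit. *)
Lemma rep_act1 (k : fieldType) (H : groupType) (V : representation k H)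
  (v : V) : rep_act 1 v = v.
Proof.
by apply: (bij_inj (@rep_bij k H V 1)); rewrite -rep_actM mulg1.
Qed.

(** The carriers of [V] and [W] may be the same space up to conversion only,
    so the map is passed explicitly and the identity map fits wherever the two
    carriers are convertible. *)
Definition mk_intertwiner (k : fieldType) (H : groupType)
    (V W : representation k H) (f : V -> W) (lf : linear f)
    (ef : forall h v, f (rep_act h v) = rep_act h (f v)) : intertwiner V W :=
  Intertwiner (introT (asboolP _) (conj lf ef)).

Section TwoRepresentation.
Context {R : realType} {H G : lieGroupType R}.
Variables (k : fieldType) (X : crossed_module H G).

Lemma xactV (g : G) (h : H) : xact X g h^-1 = (xact X g h)^-1.
Proof. by apply: (mulgI (xact X g h)); rewrite -gmulfM !mulgV xact_1. Qed.

(** The Peiffer relation, transported along [alpha g]. *)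
Lemma xact_tgt (g1 g2 : G) (a : two_cell X g1 g2) (x : H) :
  xact X g2 x * xact X g1 (cell_arrow a).2^-1 =
  xact X g1 (cell_arrow a).2^-1 * xact X g1 x.
Proof.
case: a => -[g h] /= <- <-.
by rewrite xactM xact_bd -!gmulfM -!mulgA mulgV mulg1.
Qed.

Section CellTrans.
Variables (g1 g2 : G) (a : two_cell X g1 g2).

Definition cell_component (V : representation k H) :
  intertwiner (twist_rep X g1 V) (twist_rep X g2 V).
Proof.
refine (@mk_intertwiner k H (twist_rep X g1 V) (twist_rep X g2 V)
  (fun v => @rep_act k H V (xact X g1 (cell_arrow a).2^-1) v) _ _).
- exact: rep_linear.
- by move=> h v /=; rewrite -!rep_actM xact_tgt.
Defined.

Definition cell_trans : nat_trans (twist k X g1) (twist k X g2).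
Proof.
refine (@NatTrans k (Rep k H) (Rep k H) (twist k X g1) (twist k X g2)
  cell_component _).
by move=> V W f; apply: intertwiner_eq => v /=; rewrite intertwiner_act.
Defined.

End CellTrans.

(** Coherence of a pseudofunctor between strict 2-categories involves the images
    of the 2-cells coming from associativity and unit laws in [G]; these images
    do not affect vectors, although they change the representation. *)
Lemma cell_trans_eq (g1 g2 : G) (e : g1 = g2) (V : representation k H)
    (v : V) :
  intertwiner_fun (cell_trans (eq_cell (unit_cell X) e) V) v = v :> V.
Proof. by case: g2 / e; rewrite /= invg1 xact_1 rep_act1. Qed.

Lemma cell_trans_vcomp (g1 g2 g3 : G) (b : two_cell X g2 g3)
    (a : two_cell X g1 g2) :
  cell_trans (vcell b a) = vcomp_trans (cell_trans b) (cell_trans a).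
Proof.
apply: nat_trans_eq => V; apply: intertwiner_eq => v /=.
by rewrite -rep_actM xact_tgt invgM gmulfM.
Qed.

(** The transformation that is the identity on vectors: the two functors twist
    by [x |-> alpha f (alpha g x)] and by [alpha (g f)], which are equal by a
    rewriting step but not by conversion, so that a comparison map is needed. *)
Definition twist_comp (g f : G) :
  nat_trans (comp_functor (twist k X g) (twist k X f)) (twist k X (g * f)).
Proof.
refine (@NatTrans k (Rep k H) (Rep k H)
  (comp_functor (twist k X g) (twist k X f)) (twist k X (g * f))
  (fun V => @mk_intertwiner k H (twist_rep X g (twist_rep X f V))
     (twist_rep X (g * f) V) (fun v => v) _ _) _).
- by move=> V W u; exact: intertwiner_eq.
Unshelve.
- by [].
- by move=> h v /=; rewrite xactM.
Defined.

Definition twist_comp_inv (g f : G) :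
  nat_trans (twist k X (g * f)) (comp_functor (twist k X g) (twist k X f)).
Proof.
refine (@NatTrans k (Rep k H) (Rep k H)
  (twist k X (g * f)) (comp_functor (twist k X g) (twist k X f))
  (fun V => @mk_intertwiner k H (twist_rep X (g * f) V)
     (twist_rep X g (twist_rep X f V)) (fun v => v) _ _) _).
- by move=> V W u; exact: intertwiner_eq.
Unshelve.
- by [].
- by move=> h v /=; rewrite xactM.
Defined.

Definition twist_unit : nat_trans (id_functor (Rep k H)) (twist k X 1).
Proof.
refine (@NatTrans k (Rep k H) (Rep k H) (id_functor (Rep k H)) (twist k X 1)
  (fun V => @mk_intertwiner k H V (twist_rep X 1 V) (fun v => v) _ _) _).
- by move=> V W u; exact: intertwiner_eq.
Unshelve.
- by [].
- by move=> h v /=; rewrite xact1.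
Defined.

Definition twist_unit_inv : nat_trans (twist k X 1) (id_functor (Rep k H)).
Proof.
refine (@NatTrans k (Rep k H) (Rep k H) (twist k X 1) (id_functor (Rep k H))
  (fun V => @mk_intertwiner k H (twist_rep X 1 V) V (fun v => v) _ _) _).
- by move=> V W u; exact: intertwiner_eq.
Unshelve.
- by [].
- by move=> h v /=; rewrite xact1.
Defined.

(** The action of [b] is taken at the representation twisted by the target of
    [a], and [xact_tgt] rewrites it over the source of [a], where the
    horizontal product of arrows is computed. *)
Lemma twist_comp_natural (g g' f f' : G) (b : two_cell X g g')
    (a : two_cell X f f') :
  vcomp_trans (twist_comp g' f') (hcomp_trans (cell_trans b) (cell_trans a)) =
  vcomp_trans (cell_trans (hcell b a)) (twist_comp g f).
Proof.
have tgt_factor : xact X (g * f) (hmul X b a).2^-1 =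
    xact X f (cell_arrow a).2^-1 * xact X f (xact X g (cell_arrow b).2^-1).
  have bg : (cell_arrow b).1 = g := cell_src b.
  rewrite /= bg invgM xactM !gmulfM !xactV.
  by rewrite -[xact X g (xact _ _ _)]xactM mulVg xact1.
apply: nat_trans_eq => V; apply: intertwiner_eq => v /=.
by rewrite -rep_actM xact_tgt -tgt_factor.
Qed.

Definition cell_data : pseudofunctor_data (deloop X) (TwoVect k) :=
  @PseudofunctorData (deloop X) (TwoVect k)
    (fun=> Rep k H) (fun _ _ g => twist k X g)
    (fun _ _ g1 g2 => @cell_trans g1 g2).

Definition cell_pseudofunctor : two_representation k X.
Proof.
refine (@Pseudofunctor (deloop X) (TwoVect k) cell_data _ _
  (fun _ _ _ g f => twist_comp g f) _ _ (fun _ => twist_unit) _ _ _ _).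
- move=> x y f; apply: nat_trans_eq => V; apply: intertwiner_eq => v /=.
  by rewrite invg1 xact_1 rep_act1.
- by move=> x y f g h b a; exact: cell_trans_vcomp.
- move=> x y z g f; exists (twist_comp_inv g f).
  by split; apply: nat_trans_eq => V; exact: intertwiner_eq.
- by move=> x y z g g' f f' b a; exact: twist_comp_natural.
- move=> x; exists twist_unit_inv.
  by split; apply: nat_trans_eq => V; exact: intertwiner_eq.
(* The components of an equality of functors go between representations that
   are convertible, and are identity morphisms; each coherence condition is left
   with the image of one equality in [G]. *)
- move=> x y z w h g f; apply: nat_trans_eq => V.
  rewrite /= !eq_transE !eq_cell_idm; apply: intertwiner_eq => v /=.
  exact/esym/cell_trans_eq.
- move=> x y f; apply: nat_trans_eq => V.
  rewrite /= !eq_transE !eq_cell_idm; apply: intertwiner_eq => v /=.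
  exact: cell_trans_eq.
- move=> x y f; apply: nat_trans_eq => V.
  rewrite /= !eq_transE !eq_cell_idm; apply: intertwiner_eq => v /=.
  exact: cell_trans_eq.
Defined.

End TwoRepresentation.

Theorem lemma5 (R : realType) (k : fieldType) (hk : [pchar k]%R =i pred0)
    (H G : lieGroupType R) (X : crossed_module H G) :
  exists F2 : forall g1 g2 : G,
      two_cell X g1 g2 -> nat_trans (twist k X g1) (twist k X g2),
    (forall (g1 : G) (h : H) (V : representation k H) (v : V),
       intertwiner_fun (F2 g1 (xbd X h * g1)%g (arrow_cell X g1 h) V) v
       = rep_act (xact X g1 (h^-1)%g) v) /\
    (exists P : two_representation k X,
       pf_data P =
       @PseudofunctorData (deloop X) (TwoVect k)
         (fun=> Rep k H) (fun _ _ g => twist k X g) (fun _ _ g1 g2 => F2 g1 g2)).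
Proof.
exists (@cell_trans R H G k X); split=> //.
by exists (cell_pseudofunctor k X).
Qed.
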